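(* Assume the standing assumptions (S), let $M^{(N)}:=\frac1{\sqrt N}\big(\alpha(\tfrac{|i-j|}{N})X^{(N)}_{ij}\big)_{1\le i,j\le N}$, and for $k\in\mathbb N$ set $Y^{(k)}_N:=\frac1N\operatorname{tr}(M^{(N)})^k$. Then $$\lim_{N\to\infty}\mathbb V\big(Y^{(k)}_N\big)=0\qquad\text{for all }k\in\mathbb N,$$ where $\mathbb V$ denotes the variance.
   Context: Standing assumptions (S): $\alpha:[0,1]\to\mathbb R$ is bounded and Riemann-integrable. For each $N\in\mathbb N$, $(X^{(N)}_{ij})_{1\le i,j\le N}$ are real random variables on a common probability space with $X^{(N)}_{ij}=X^{(N)}_{ji}$, $\mathbb E X^{(N)}_{ij}=0$, $\mathbb E (X^{(N)}_{ij})^2=1$, and $\sup_N\max_{i,j}\mathbb E|X^{(N)}_{ij}|^k\le R_k<\infty$ for every $k\ge 1$. For each $N$, $\sim$ is an equivalence relation on $\{1,\dots,N\}^2$ with $(p,q)\sim(q,p)$ for all $p,q$, satisfying, as $N\to\infty$: (C1) $\max_p\#\{(q,r,s)\in\{1,\dots,N\}^3:(p,q)\sim(r,s)\}=o(N^2)$; (C2) $\max_{p,q,r}\#\{s\in\{1,\dots,N\}:(p,q)\sim(r,s)\}\le B<\infty$ with $B$ independent of $N$; (C3) $\#\{(p,q,r)\in\{1,\dots,N\}^3:(p,q)\sim(q,r),\ r\neq p\}=o(N^2)$. Entries indexed by non-equivalent pairs are independent: for each $N$, the families $\{X^{(N)}_{pq}:(p,q)\in C\}$, $C$ ranging over the distinct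 $\sim$-equivalence classes, are mutually independent. *)

(* Defs.v *)
From HB Require Import structures.
From mathcomp Require Import all_boot all_order all_algebra.
From mathcomp Require Import all_classical all_reals all_analysis.
From mathcomp Require Import Rstruct Rstruct_topology.
From Stdlib Require Import Rdefinitions RiemannInt.

Set Implicit Arguments.
Unset Strict Implicit.
Unset Printing Implicit Defensive.
Import Order.TTheory GRing.Theory Num.Theory.
Local Open Scope classical_set_scope.
Local Open Scope ring_scope.

(* We work over Stdlib's concrete real numbers R, which is a realType
   via Rstruct, so that Stdlib's Riemann integrability can be used. *)
Notation Rst := Rdefinitions.R.

Definition Riemann_integrable01 (f : Rst -> Rst) : Type :=
  Riemann_integrable f (0 : Rst) (1 : Rst).

(* index pairs (p,q), with indices 0..N-1 standing for 1..N *)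
Definition ipair (N : nat) := ('I_N * 'I_N)%type.

Definition eqclasses (N : nat) (eqv : rel (ipair N)) : {set {set ipair N}} :=
  equivalence_partition eqv [set: ipair N].

(* Mutual independence of the families {X_pq : (p,q) in C}, C ranging over the
   equivalence classes: the joint law of all entries factorizes over the
   classes (on all measurable rectangles). *)
Definition indep_over_classes d (T : measurableType d) (P : probability T Rst)
  (N : nat) (eqv : rel (ipair N)) (X : 'I_N -> 'I_N -> T -> Rst) : Prop :=
  forall B : 'I_N -> 'I_N -> set Rst,
    (forall i j, @measurable _ (measurableTypeR Rst) (B i j)) ->
    P (\bigcap_(p in [set: ipair N]) (X p.1 p.2 @^-1` B p.1 p.2)) =
    (\prod_(C in eqclasses eqv)
       P (\bigcap_(p in [set q | q \in C]) (X p.1 p.2 @^-1` B p.1 p.2)))%E.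

Definition countC1 (N : nat) (eqv : rel (ipair N)) : nat :=
  \max_(p < N) #|[set x : 'I_N * 'I_N * 'I_N | eqv (p, x.1.1) (x.1.2, x.2)]|.

Definition countC2 (N : nat) (eqv : rel (ipair N)) (p q r : 'I_N) : nat :=
  #|[set s : 'I_N | eqv (p, q) (r, s)]|.

Definition countC3 (N : nat) (eqv : rel (ipair N)) : nat :=
  #|[set x : 'I_N * 'I_N * 'I_N | eqv (x.1.1, x.1.2) (x.1.2, x.2) && (x.2 != x.1.1)]|.

Definition little_o_N2 (f : nat -> nat) : Prop :=
  (fun N : nat => ((f N)%:R / (N%:R ^+ 2) : Rst)) @ \oo --> (0 : Rst).

Definition Mmat (N : nat) (alpha : Rst -> Rst) (T : Type)
  (X : 'I_N -> 'I_N -> T -> Rst) (w : T) : 'M[Rst]_N :=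
  \matrix_(i, j) (alpha ((maxn i j - minn i j)%:R / N%:R) * X i j w / Num.sqrt N%:R).

Definition Ytr (k N : nat) (alpha : Rst -> Rst) (T : Type)
  (X : 'I_N -> 'I_N -> T -> Rst) (w : T) : Rst :=
  \tr ((Mmat alpha X w) ^+ k) / N%:R.

(* Main.v *)
Require Import Defs.
From HB Require Import structures.
From mathcomp Require Import all_boot all_order all_algebra.
From mathcomp Require Import all_classical all_reals all_analysis.
From mathcomp Require Import Rstruct Rstruct_topology.
From mathcomp Require Import measurable_realfun zify ring.
Import Order.TTheory GRing.Theory Num.Theory.
Local Open Scope ring_scope.

Set Implicit Arguments.
Unset Strict Implicit.
Unset Printing Implicit Defensive.

(** Expanding the trace, the variance of Y is N^-(k+2) times a sum over pairs
    (s, t) of closed walks of length k of bounded weights times Cov(X_s, X_t),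
    where X_s is the product of the entries along s. The covariance vanishes
    if some class is visited by exactly one of the 2k edges (the corresponding
    centred entry factors out of all expectations) or if s and t have no class
    in common (X_s and X_t are then independent); otherwise it is O(1).

    Hence it suffices to count the pairs in which every class is visited at
    least twice, so that at most k classes occur, and some class is shared.
    Rotate both walks so that the shared class is that of their first edges
    (v, x) and (u, y): by (C1) there are N o(N^2) choices of these. Completing
    the walks step by step, an edge in an already visited class leaves O(1)
    choices by (C2), and one in a new class leaves N; the latter happens at most
    k - 1 times. The count is thus o(N^(k+2)). *)

(** * Counting pairs of closed walks *)

Lemma sum_tuple_cons (R : nmodType) (V : finType) (m : nat)
    (F : m.+1.-tuple V -> R) :
  \sum_(w : m.+1.-tuple V) F w = \sum_(x : V) \sum_(w : m.-tuple V) F (cons_tuple x w).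
Proof.
rewrite pair_bigA /=.
rewrite (reindex (fun xw : V * m.-tuple V => cons_tuple xw.1 xw.2)) //=.
exists (fun w : m.+1.-tuple V => (thead w, behead_tuple w)).
- by move=> [x w] _ /=; congr pair; apply: val_inj.
- by move=> w _; apply: val_inj => /=; case/tupleP: w.
Qed.

(** The length of [s] is the sum of the multiplicities of its distinct values, each of which is at
    least 2. *)
Lemma double_size_undup_le (C : eqType) (s : seq C) :
  all (fun c => 1 < count_mem c s)%N s -> ((size (undup s)).*2 <= size s)%N.
Proof.
move=> /allP hs.
have -> : size s = (\sum_(c <- undup s) count_mem c s)%N.
  rewrite -[LHS]sum1_size -big_undup_iterop_count.
  by apply: eq_bigr => c _; rewrite Monoid.iteropE iter_addn_0 mul1n.
rewrite -muln2 mulnC -sum1_size big_distrr /= big_seq [leqRHS]big_seq.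
by apply: leq_sum => c; rewrite mem_undup => /hs; rewrite muln1.
Qed.

Section Walks.
Variables (V : finType) (C : eqType) (cls : V * V -> C).

(** Pairing [s] with its rotation includes the closing edge and makes a change of starting point
    commute with taking edges, as [closed_edges_rot] records. *)
Definition closed_edges (s : seq V) : seq (V * V) := zip s (rot 1 s).

Lemma closed_edges_cons x s :
  closed_edges (x :: s) = pairmap pair x (rcons s x).
Proof.
rewrite /closed_edges rot1_cons; elim: s {1 3}x => //= y s IH z.
by rewrite IH.
Qed.

Lemma size_closed_edges s : size (closed_edges s) = size s.
Proof. by rewrite size_zip size_rot minnn. Qed.

Lemma zip_rot (S1 S2 : Type) (n : nat) (s : seq S1) (t : seq S2) :
  size s = size t -> zip (rot n s) (rot n t) = rot n (zip s t).
Proof.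
move=> st; rewrite /rot zip_cat; last by rewrite !size_drop st.
by congr cat; elim: n s t st => [|n IH] [|a s] [|b t] //= [] /IH ->.
Qed.

Lemma closed_edges_rot n s : closed_edges (rot n s) = rot n (closed_edges s).
Proof. by rewrite /closed_edges rot_rot zip_rot ?size_rot. Qed.

Definition nclasses (L : seq (V * V)) : nat := size (undup (map cls L)).

Lemma nclasses_cons e L :
  nclasses (e :: L) = ((cls e \notin map cls L) + nclasses L)%N.
Proof. by rewrite /nclasses /=; case: ifP. Qed.

Lemma perm_nclasses L L' : perm_eq L L' -> nclasses L = nclasses L'.
Proof.
by move=> LL'; apply/perm_size/perm_undup/perm_mem/perm_map.
Qed.

Variable B : nat.
Hypothesis clsB : forall (e : V * V) v, (#|[set x | cls e == cls (v, x)]| <= B)%N.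

(** The set is a union, over the edges of [L], of sets of size at most [B]. *)
Lemma card_seen_le v (L : seq (V * V)) :
  (#|[set x | cls (v, x) \in map cls L]| <= size L * B)%N.
Proof.
elim: L => [|e L IH].
  by rewrite (_ : [set _ | _] = finset.set0) ?cards0 //; apply/finset.setP=> x; rewrite !inE.
rewrite (_ : [set _ | _] =
  [set x | cls e == cls (v, x)] :|: [set x | cls (v, x) \in map cls L]).
  by rewrite mulSn (leq_trans (leq_card_setU _ _)) ?leq_add.
by apply/finset.setP=> x; rewrite !inE /= eq_sym.
Qed.

Let q : rat := #|V|%:R^-1.

Let q_ge0 : 0 <= q. Proof. by rewrite invr_ge0 ler0n. Qed.

(* Weighting a walk by #|V| ^- (number of classes) makes a step into a new
   class and a step into an old one equally cheap. *)
Lemma sum_walks_le (K m : nat) v (L : seq (V * V)) :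
  (size L + m <= K)%N ->
  \sum_(w : m.-tuple V) q ^+ nclasses (pairmap pair v w ++ L)
    <= (K * B).+1%:R ^+ m * q ^+ nclasses L.
Proof.
elim: m v L => [|m IH] v L sL.
  rewrite (big_pred1 [tuple]) ?mul1r // => w.
  by apply/esym/eqP; rewrite (tuple0 w).
rewrite sum_tuple_cons /=.
(* The first edge joins the list of visited edges. The order of that list is irrelevant, since
   [nclasses] is invariant under permutation. *)
have step x : \sum_(w : m.-tuple V)
      q ^+ nclasses ((v, x) :: pairmap pair x w ++ L) <=
    (K * B).+1%:R ^+ m * q ^+ nclasses ((v, x) :: L).
  have := IH x ((v, x) :: L); rewrite /= addSnnS => /(_ sL).
  congr (_ <= _); apply: eq_bigr => w _; congr (_ ^+ _).
  by apply: perm_nclasses; rewrite perm_catC /= perm_cons perm_catC.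
apply: (le_trans (ler_sum _ (fun x _ => step x))).
rewrite -mulr_sumr exprSr -mulrA ler_wpM2l ?exprn_ge0 ?ler0n //.
have -> : \sum_(x : V) q ^+ nclasses ((v, x) :: L) =
    q ^+ nclasses L * \sum_(x : V) q ^+ (cls (v, x) \notin map cls L).
  by rewrite mulr_sumr; apply: eq_bigr => x _; rewrite nclasses_cons addnC exprD.
rewrite mulrC ler_wpM2r ?exprn_ge0 //.
(* The next vertices are split by the class of the new edge. At most [K * B] of them give an old
   class, each with factor 1. The others give a new class with factor [q] each, and contribute at
   most [#|V| * q <= 1], which is the successor in [(K * B).+1]. *)
rewrite (bigID (fun x => cls (v, x) \in map cls L)) /= -natr1.
apply: lerD.
  rewrite (eq_bigr (fun=> 1)) => [|x -> //].
  rewrite sumr_const ler_nat -cardsE (leq_trans (card_seen_le _ _)) //.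
  by rewrite leq_mul2r (leq_trans (leq_addr _ _) sL) orbT.
rewrite (eq_bigr (fun=> q)) => [|x -> //].
rewrite sumr_const -mulr_natr /q.
have [->|V0] := eqVneq #|V| 0%N; first by rewrite invr0 mul0r.
by rewrite ler_pdivrMl ?ltr0n ?lt0n // mulr1 ler_nat max_card.
Qed.

Variable D : nat.
Hypothesis clsD : forall v,
  (#|[set z : V * V * V | cls (v, z.1.1) == cls (z.1.2, z.2)]| <= D)%N.

Definition doubled (L : seq (V * V)) : bool :=
  all (fun c => 1 < count_mem c (map cls L))%N (map cls L).

Definition linked (s t : seq V) : bool :=
  has (fun e => cls e \in map cls (closed_edges t)) (closed_edges s).

Lemma sum_linked_open_walks_le (k : nat) :
  \sum_(v : V) \sum_(w : k.+1.-tuple V) \sum_(u : V) \sum_(z : k.+1.-tuple V)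
    (cls (v, thead w) == cls (u, thead z))%:R *
      q ^+ nclasses (pairmap pair v w ++ pairmap pair u z) 
  <= (k.+1.*2 * B).+1%:R ^+ k.*2 * D%:R.
Proof.
set c := (_ * B).+1%:R.
(* The second walk is completed first, the whole first walk counting as visited. *)
have inner v x u y (w' : k.-tuple V) : cls (v, x) = cls (u, y) ->
  \sum_(z : k.-tuple V) q ^+ nclasses (pairmap pair v (x :: w') ++ pairmap pair u (y :: z))
  <= c ^+ k * q ^+ nclasses (pairmap pair x w' ++ [:: (v, x); (u, y)]).
  move=> e /=.
  have sz : (size (pairmap pair x w' ++ [:: (v, x); (u, y)]) + k <= k.+1.*2)%N.
    by rewrite size_cat size_pairmap size_tuple /= -addnn !addnS addn0 !addSn addnn.
  have := sum_walks_le y sz.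
  congr (_ <= _); apply: eq_bigr => z _; congr (_ ^+ _); apply: perm_nclasses.
  by apply/permP=> p; rewrite /= !count_cat /= ?count_cat /=; lia.
(* Then the first walk is completed, with only the two first edges as visited ones. *)
have outer v x u y : cls (v, x) = cls (u, y) ->
   \sum_(w' : k.-tuple V) \sum_(z : k.-tuple V)
     q ^+ nclasses (pairmap pair v (x :: w') ++ pairmap pair u (y :: z)) <=
   c ^+ k.*2 * q.
  move=> e; apply: le_trans (ler_sum _ (fun w' _ => inner v x u y w' e)) _.
  rewrite -mulr_sumr -addnn exprD -mulrA ler_wpM2l ?exprn_ge0 ?ler0n //.
  have sz : (size [:: (v, x); (u, y)] + k <= k.+1.*2)%N by rewrite -addnn /= addSn addnS !ltnS leq_addr.
  apply: le_trans (sum_walks_le x sz) _.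
  by rewrite /nclasses /= e mem_head.
have -> : \sum_(v : V) \sum_(w : k.+1.-tuple V) \sum_(u : V) \sum_(z : k.+1.-tuple V)
    (cls (v, thead w) == cls (u, thead z))%:R *
      q ^+ nclasses (pairmap pair v w ++ pairmap pair u z) =
  \sum_(v : V) \sum_(a : V * V * V) (cls (v, a.1.1) == cls (a.1.2, a.2))%:R *
    \sum_(w' : k.-tuple V) \sum_(z : k.-tuple V)
     q ^+ nclasses (pairmap pair v (a.1.1 :: w') ++ pairmap pair a.1.2 (a.2 :: z)).
  apply: eq_bigr => v _.
  rewrite -(pair_bigA _ (fun xu y => (cls (v, xu.1) == cls (xu.2, y))%:R *
    \sum_(w' : k.-tuple V) \sum_(z : k.-tuple V)
     q ^+ nclasses (pairmap pair v (xu.1 :: w') ++ pairmap pair xu.2 (y :: z)))) /=.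
  rewrite -(pair_bigA _ (fun x u => \sum_y (cls (v, x) == cls (u, y))%:R *
    \sum_(w' : k.-tuple V) \sum_(z : k.-tuple V)
     q ^+ nclasses (pairmap pair v (x :: w') ++ pairmap pair u (y :: z)))) /=.
  rewrite sum_tuple_cons; apply: eq_bigr => x _.
  rewrite exchange_big; apply: eq_bigr => u _ /=.
  under eq_bigr do rewrite sum_tuple_cons.
  rewrite exchange_big; apply: eq_bigr => y _ /=.
  by rewrite mulr_sumr; apply: eq_bigr => w' _; rewrite mulr_sumr.
apply: (@le_trans _ _ (\sum_(v : V) (D%:R * (c ^+ k.*2 * q)))).
  apply: ler_sum => v _.
  apply: (@le_trans _ _ (\sum_(a : V * V * V)
      (cls (v, a.1.1) == cls (a.1.2, a.2))%:R * (c ^+ k.*2 * q))).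
    apply: ler_sum => a _; case: eqP => [/outer|_]; last by rewrite !mul0r.
    by rewrite !mul1r.
  rewrite -mulr_suml ler_wpM2r ?mulr_ge0 ?exprn_ge0 ?ler0n //.
  rewrite -natr_sum ler_nat -big_mkcond /= sum1_card.
  by have := clsD v; rewrite cardsE.
set y := D%:R * _.
have -> : \sum_(v : V) y = #|V|%:R * y by rewrite sumr_const mulr_natl.
rewrite {}/y; have [->|V0] := eqVneq #|V| 0%N; first by rewrite mul0r mulr_ge0 ?exprn_ge0 ?ler0n.
rewrite mulrCA (mulrCA _ (c ^+ _)) /q divff ?pnatr_eq0 // mulr1.
by rewrite mulrC.
Qed.


(** The [2(k+1)] edges of a doubled pair occupy at most [k+1] classes, so its weight is at least
    [q ^+ k.+1]. Hence the number of such pairs is at most [#|V| ^ k.+1] times the sum of their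
    weights. *)
Lemma card_doubled_linked_first_le (k : nat) :
  (#|[set st : k.+1.-tuple V * k.+1.-tuple V |
      doubled (closed_edges st.1 ++ closed_edges st.2) &&
      (map cls (take 1 (closed_edges st.1)) == map cls (take 1 (closed_edges st.2)))]|
   <= #|V| ^ k.+1 * ((k.+1.*2 * B).+1 ^ k.*2 * D))%N.
Proof.
set S := [set _ | _].
case: (posnP #|V|) => [V0|Vpos].
  suff -> : S = finset.set0 by rewrite cards0.
  by apply/finset.setP => -[s t]; have := max_card (pred1 (thead s)); rewrite card1 V0.
have qV : #|V|%:R * q = 1 by rewrite divff // pnatr_eq0 -lt0n.
rewrite -(ler_nat rat) natrM -sum1_card natr_sum.
(* A closed walk is opened at its first vertex, which is repeated at the end. By [gE] the edges stay
   the same. *)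
pose g (s : k.+1.-tuple V) : V * k.+1.-tuple V := (thead s, [tuple of rcons (behead s) (thead s)]).
have g_inj : injective g.
  move=> s t; case/tupleP: s => x s; case/tupleP: t => y t [].
  rewrite !theadE => exy /=; subst y => /rcons_inj [st].
  by apply: val_inj; rewrite /= st.
have gE (s : k.+1.-tuple V) : closed_edges s = pairmap pair (g s).1 (g s).2.
  by case/tupleP: s => x s; rewrite /= closed_edges_cons.
pose F (a b : V * k.+1.-tuple V) : rat :=
  (cls (a.1, thead a.2) == cls (b.1, thead b.2))%:R *
      q ^+ nclasses (pairmap pair a.1 a.2 ++ pairmap pair b.1 b.2).
have F_ge0 a b : 0 <= F a b by rewrite mulr_ge0 ?exprn_ge0 ?ler0n.
apply: (@le_trans _ _ (#|V|%:R ^+ k.+1 * \sum_(st in S) F (g st.1) (g st.2))).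
  rewrite mulr_sumr; apply: ler_sum => -[s t]; rewrite inE /= => /andP[dbl first].
  have -> : F (g s) (g t) = q ^+ nclasses (closed_edges s ++ closed_edges t).
    rewrite /F -!gE (_ : _ == _) ?mul1r //; move: first; rewrite !gE.
    by case/tupleP: (g s).2 => a s'; case/tupleP: (g t).2 => b t' /=; rewrite !take0 /= => /eqP[->].
  move/double_size_undup_le: dbl.
  rewrite size_map size_cat !size_closed_edges !size_tuple addnn leq_double.
  rewrite -/(nclasses _); move: (nclasses _) => n dle.
  rewrite -(subnKC dle) exprD mulrAC -exprMn qV expr1n mul1r exprn_ege1 //.
  by rewrite ler1n.
rewrite natrX ler_wpM2l ?exprn_ge0 ?ler0n // natrM natrX.
apply: le_trans (sum_linked_open_walks_le k).
(* The sum is enlarged from the image of [S] under the injective opening map to all pairs of open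
   walks, every term being nonnegative. *)
apply: (@le_trans _ _ (\sum_a \sum_b F a b)); last first.
  rewrite -(pair_bigA _ (fun v w => \sum_b F (v, w) b)) /=.
  apply: ler_sum => v _; apply: ler_sum => w _.
  by rewrite -(pair_bigA _ (fun u z => F (v, w) (u, z))).
rewrite pair_bigA /=.
have gg_inj : injective (fun st : k.+1.-tuple V * k.+1.-tuple V => (g st.1, g st.2)).
  by move=> [s t] [s' t'] /= [*]; congr pair; apply: g_inj; apply/eqP; rewrite xpair_eqE; apply/andP; split; apply/eqP=> //; apply: val_inj.
rewrite -(big_imset (fun ab => F ab.1 ab.2) (in2W gg_inj)) /=.
rewrite big_mkcond /=; apply: ler_sum => ab _; case: ifP => // _.
Qed.

(** Rotating each walk to the position of its linked edge brings the common class to the front and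
    keeps the pair doubled. There are [k.+1 ^ 2] pairs of positions, and for each of them the
    rotation is injective. *)
Lemma card_doubled_linked_le (k : nat) :
  (#|[set st : k.+1.-tuple V * k.+1.-tuple V |
      doubled (closed_edges st.1 ++ closed_edges st.2) && linked st.1 st.2]|
   <= k.+1 ^ 2 * (#|V| ^ k.+1 * ((k.+1.*2 * B).+1 ^ k.*2 * D)))%N.
Proof.
set S := [set _ | _].
pose good (st : k.+1.-tuple V * k.+1.-tuple V) :=
  doubled (closed_edges st.1 ++ closed_edges st.2) &&
      (map cls (take 1 (closed_edges st.1)) == map cls (take 1 (closed_edges st.2))).
pose r (ab : 'I_k.+1 * 'I_k.+1) (st : k.+1.-tuple V * k.+1.-tuple V) :=
  ([tuple of rot ab.1 st.1], [tuple of rot ab.2 st.2]).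
have sub : S \subset \bigcup_ab [set st | good (r ab st)].
  apply/fintype.subsetP=> -[s t]; rewrite inE /= => /andP[dbl /hasP[e es /mapP[f ft ef]]].
  have ha : (index e (closed_edges s) < k.+1)%N.
    by rewrite -[ltnRHS](size_tuple s) -size_closed_edges index_mem.
  have hb : (index f (closed_edges t) < k.+1)%N.
    by rewrite -[ltnRHS](size_tuple t) -size_closed_edges index_mem.
  apply/finset.bigcupP; exists (Ordinal ha, Ordinal hb); rewrite // inE /good /=.
  rewrite !closed_edges_rot; apply/andP; split.
    rewrite /doubled; set L := map _ _.
    have LL : perm_eq L (map cls (closed_edges s ++ closed_edges t)).
      by apply: perm_map; apply: perm_cat; rewrite perm_rot.
    rewrite (perm_all _ LL) (eq_all (a2 := fun c => 1 < count_mem c (map cls (closed_edges s ++ closed_edges t)))%N) //.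
    by move=> c /=; move/permP: LL => ->.
  rewrite /rot (drop_nth e) ?index_mem // (drop_nth f (n := index f _)) ?index_mem //=.
  by rewrite !take0 /= !nth_index // ef.
apply: leq_trans (subset_leq_card sub) _.
apply: (@leq_trans (\sum_ab #|[set st | good (r ab st)]|)%N).
  elim/big_ind2: _ => [|A m A' m' Am Am'|//]; first by rewrite cards0.
  by rewrite (leq_trans (leq_card_setU _ _)) ?leq_add.
apply: (@leq_trans (\sum_(ab : 'I_k.+1 * 'I_k.+1) (#|V| ^ k.+1 * ((k.+1.*2 * B).+1 ^ k.*2 * D)))%N).
  apply: leq_sum => ab _; apply: leq_trans (card_doubled_linked_first_le k).
  have r_inj : injective (r ab).
    by move=> [s t] [s' t'] [/rot_inj es /rot_inj et]; congr pair; apply: val_inj.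
  rewrite -(card_imset _ r_inj); apply: subset_leq_card.
  by apply/fintype.subsetP=> _ /imsetP[st + ->]; rewrite !inE.
by rewrite sum_nat_const card_prod card_ord mulnn.
Qed.
End Walks.

(** * Traces of powers and equivalence classes *)

Section PowerTrace.
Variables (R : comNzRingType) (N : nat) (M : 'M[R]_N).

Lemma matrix_exp_walks (k : nat) v w :
  (M ^+ k.+1) v w =
  \sum_(s : k.-tuple 'I_N) \prod_(e <- pairmap pair v (rcons s w)) M e.1 e.2.
Proof.
elim: k v => [|k IH] v.
  rewrite expr1 (big_pred1 [tuple]) /= ?big_seq1 // => s.
  by apply/esym/eqP; rewrite (tuple0 s).
rewrite exprS mxE sum_tuple_cons; apply: eq_bigr => u _.
by rewrite IH mulr_sumr; apply: eq_bigr => s _ /=; rewrite big_cons.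
Qed.

Lemma trace_exp_closed_walks (k : nat) :
  \tr (M ^+ k.+1) =
  \sum_(s : k.+1.-tuple 'I_N) \prod_(e <- closed_edges s) M e.1 e.2.
Proof.
rewrite /mxtrace sum_tuple_cons; apply: eq_bigr => v _.
by rewrite matrix_exp_walks; apply: eq_bigr => s _; rewrite /= closed_edges_cons.
Qed.
End PowerTrace.

Definition eqclass (N : nat) (eqv : rel (ipair N)) (e : ipair N) : {set ipair N} :=
  [set f | eqv e f].

Lemma eq_eqclass (N : nat) (eqv : rel (ipair N)) : equivalence_rel eqv ->
  forall e f, (eqclass eqv e == eqclass eqv f) = eqv e f.
Proof.
move=> /equivalence_relP[refl trans] e f; apply/eqP/idP => [ef|ef].
  have : f \in eqclass eqv f by rewrite inE.
  by rewrite -ef inE.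
by apply/finset.setP=> g; rewrite !inE (trans _ _ ef).
Qed.

Local Open Scope classical_set_scope.

(** * Expectations of products over independent blocks *)

Section WeightedPushforward.
Context d (T : measurableType d) (R : realType) (P : {measure set T -> \bar R}).
Variables (X : T -> R) (W1 W2 : T -> \bar R).
Hypothesis mX : measurable_fun [set: T] X.
Hypothesis mW1 : measurable_fun [set: T] W1.
Hypothesis mW2 : measurable_fun [set: T] W2.
Hypothesis W1_ge0 : forall w, (0 <= W1 w)%E.
Hypothesis W2_ge0 : forall w, (0 <= W2 w)%E.
Local Open Scope ereal_scope.

Import HBNNSimple.

Let int_simple (W : T -> \bar R) (h : {nnsfun R >-> R}) :
    measurable_fun [set: T] W -> (forall w, 0 <= W w) ->
  \int[P]_w ((h (X w))%:E * W w) =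
  \sum_(y \in range h) (y%:E * \int[P]_w ((\1_(h @^-1` [set y]) (X w))%:E * W w)).
Proof.
move=> mW W0.
have mi y : measurable_fun [set: T] (fun w => (\1_(h @^-1` [set y]) (X w) : R)%:E * W w).
  apply: emeasurable_funM => //; apply/measurable_EFinP.
  exact: (measurableT_comp (measurable_indic _)).
have i0 y w : 0 <= (\1_(h @^-1` [set y]) (X w) : R)%:E * W w.
  by rewrite mule_ge0.
transitivity (\int[P]_w \sum_(y \in range h)
    (y%:E * ((\1_(h @^-1` [set y]) (X w))%:E * W w))).
  apply: eq_integral => w _; rewrite fimfunE -fsumEFin // ge0_mule_fsuml.
    by apply: eq_fsbigr => y _; rewrite EFinM muleA.
  by move=> y; rewrite EFinM nnfun_muleindic_ge0.
have nn y w : 0 <= y%:E * ((\1_(h @^-1` [set y]) (X w))%:E * W w).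
  by rewrite muleA mule_ge0 // nnfun_muleindic_ge0.
rewrite ge0_integral_fsum//; last first.
  by move=> y; apply: measurable_funeM.
apply: eq_fsbigr => y; rewrite inE => -[x _ <-].
by rewrite ge0_integralZl// lee_fin.
Qed.

(** The hypothesis says that the images under [X] of the measures with densities [W1] and [W2] agree
    on measurable sets. Linearity extends this to simple functions, and monotone convergence to
    nonnegative measurable ones. *)
Lemma eq_integral_weighted_comp :
  (forall B, measurable B ->
    \int[P]_w ((\1_B (X w))%:E * W1 w) = \int[P]_w ((\1_B (X w))%:E * W2 w)) ->
  forall f : R -> R, measurable_fun [set: R] f -> (forall x, 0 <= f x)%R ->
    \int[P]_w ((f (X w))%:E * W1 w) = \int[P]_w ((f (X w))%:E * W2 w).
Proof.
move=> eqB f mf f0.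
have mEf : measurable_fun [set: R] (EFin \o f) by exact/measurable_EFinP.
pose g := nnsfun_approx measurableT mEf.
have mono (W : T -> \bar R) : measurable_fun [set: T] W -> (forall w, 0 <= W w) ->
    \int[P]_w ((f (X w))%:E * W w) = limn (fun n => \int[P]_w ((g n (X w))%:E * W w)).
  move=> mW W0; rewrite -monotone_convergence//=.
  - apply: eq_integral => w _; apply/esym/cvg_lim => //=.
    have cvg_g : (g n (X w))%:E @[n --> \oo] --> (f (X w))%:E.
      by apply: (@cvg_nnsfun_approx _ _ _ _ measurableT _ mEf) => // x _; rewrite lee_fin.
    have [fX0|fX0] := eqVneq (f (X w)) 0%R; last first.
      apply: cvgeM cvg_g (cvg_cst _).
      have [Wfin|Winf] := boolP (W w \is a fin_num); first exact: mule_def_fin.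
      exact: mule_def_neq0_infty.
    have gX0 n : g n (X w) = 0%R.
      apply/eqP; rewrite eq_le; apply/andP; split => //.
      rewrite -fX0 -lee_fin /g nnsfun_approxE.
      by apply: (@le_approx _ _ _ _ (EFin \o f)) => // x _; rewrite lee_fin.
    under eq_fun do rewrite gX0 mul0e.
    by rewrite fX0 mul0e; exact: cvg_cst.
  - move=> n; apply: emeasurable_funM => //; apply/measurable_EFinP.
    exact: (measurableT_comp (measurable_funP (g n))).
  - by move=> n w _; rewrite mule_ge0 // lee_fin.
  - move=> w _ a b ab; rewrite lee_wpmul2r // lee_fin; exact/lefP/nd_nnsfun_approx.
rewrite !mono //; congr (limn _); apply/funext => n.
by rewrite !int_simple //; apply: eq_fsbigr => y _; rewrite eqB.
Qed.

End WeightedPushforward.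

Section IndependentProducts.
Context d (T : measurableType d) (R : realType) (P : probability T R).
Variables (I : finType) (X : I -> T -> R).
Hypothesis mX : forall i, measurable_fun [set: T] (X i).

(** Independence of the family indexed by [A] from the remaining variables, tested on rectangles
    only. *)
Definition indep_split (A : pred I) : Prop :=
  forall B : I -> set R, (forall i, measurable (B i)) ->
    P (\bigcap_(i in [set: I]) X i @^-1` B i) =
    (P (\bigcap_(i in [set i | A i]) X i @^-1` B i) *
     P (\bigcap_(i in [set i | ~~ A i]) X i @^-1` B i))%E.

Let mprod (Q : pred I) (f : I -> R -> R) :
  (forall i, measurable_fun [set: R] (f i)) ->
  measurable_fun [set: T] (fun w => \prod_(i | Q i) f i (X i w)).
Proof.
move=> mf; under eq_fun do rewrite -big_filter.
by apply: measurable_prod => i _; exact: measurableT_comp.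
Qed.

Lemma prod_indic (Q : pred I) (B : I -> set R) w :
  \prod_(i | Q i) \1_(B i) (X i w) =
  \1_(\bigcap_(i in [set i | Q i]) X i @^-1` B i) w :> R.
Proof.
rewrite indicE; have [|] := boolP (w \in _).
  rewrite inE => wB; apply: big1 => i Qi; rewrite indicE mem_set //.
  exact: wB.
rewrite notin_setE => wB.
have [i Qi nBi] : exists2 i, Q i & ~ B i (X i w).
  by apply: contrapT => h; apply: wB => i /= Qi; apply: contrapT => nB; apply: h; exists i.
by rewrite (bigD1 i) //= indicE memNset // mul0r.
Qed.

Definition splits (A : pred I) (f : I -> R -> R) : Prop :=
  (\int[P]_w (\prod_i f i (X i w))%:E =
   \int[P]_w (\prod_(i | A i) f i (X i w))%:E *
   \int[P]_w (\prod_(i | ~~ A i) f i (X i w))%:E)%E.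

Lemma splitsC A f : splits (fun i => ~~ A i) f -> splits A f.
Proof.
rewrite /splits => ->; rewrite muleC; congr (_ * _)%E.
apply: eq_integral => w _; congr EFin; apply: eq_bigl => i /=.
by rewrite negbK.
Qed.

Let upd (f : I -> R -> R) q h i := if i == q then h else f i.

(** With the other factors fixed, both sides are integrals of [f q (X q w)] against a nonnegative
    weight: [W1] on the left and, on the right, [W2], which absorbs the integral [c] over the block
    not containing [q]. Agreement on indicators is then enough. *)
Lemma splits_step (A : pred I) (f : I -> R -> R) q : A q ->
  (forall i, measurable_fun [set: R] (f i)) -> (forall i x, 0 <= f i x) ->
  (forall B, measurable B -> splits A (upd f q \1_B)) -> splits A f.
Proof.
move=> Aq mf f0 hB.
have prod0 (Q : pred I) w : 0 <= \prod_(i | Q i) f i (X i w) by exact: prodr_ge0.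
pose c := (\int[P]_w (\prod_(i | ~~ A i) f i (X i w))%:E)%E.
have c0 : (0 <= c)%E by apply: integral_ge0 => w _; rewrite lee_fin.
pose W1 w := (\prod_(i | i != q) f i (X i w))%:E.
pose W2 w := (c * (\prod_(i | A i && (i != q)) f i (X i w))%:E)%E.
have mW1 : measurable_fun [set: T] W1 by apply/measurable_EFinP/mprod.
have mA : measurable_fun [set: T] (fun w => (\prod_(i | A i && (i != q)) f i (X i w))%:E).
  by apply/measurable_EFinP/mprod.
have mW2 : measurable_fun [set: T] W2 by apply: measurable_funeM.
have W10 w : (0 <= W1 w)%E by rewrite lee_fin.
have W20 w : (0 <= W2 w)%E by rewrite mule_ge0 // lee_fin.
have lhs h : (\int[P]_w (\prod_i upd f q h i (X i w))%:E =
              \int[P]_w ((h (X q w))%:E * W1 w))%E.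
  apply: eq_integral => w _; rewrite (bigD1 q) //= {1}/upd eqxx EFinM; congr (_ * _%:E)%E.
  by apply: eq_bigr => i /negPf iq; rewrite /upd iq.
have rhs (h : R -> R) : measurable_fun [set: R] h -> (forall x, 0 <= h x) ->
   (\int[P]_w (\prod_(i | A i) upd f q h i (X i w))%:E *
    \int[P]_w (\prod_(i | ~~ A i) upd f q h i (X i w))%:E =
    \int[P]_w ((h (X q w))%:E * W2 w))%E.
  move=> mh h0; rewrite muleC.
  rewrite (_ : (\int[P]_w (\prod_(i | ~~ A i) _)%:E)%E = c); last first.
    apply: eq_integral => w _; congr EFin; apply: eq_bigr => i nAi.
    by rewrite /upd; case: eqP => // iq; rewrite iq Aq in nAi.
  rewrite -ge0_integralZl //.
  - apply: eq_integral => w _; rewrite (bigD1 q) //= {1}/upd eqxx EFinM muleCA.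
    congr (_ * (_ * _%:E))%E.
    by apply: eq_bigr => i /andP[_ /negPf iq]; rewrite /upd iq.
  - by apply/measurable_EFinP/mprod => i; rewrite /upd; case: ifP.
  - move=> w _; rewrite lee_fin prodr_ge0 // => i _; rewrite /upd; case: ifP => _ //.
have fE : upd f q (f q) = f by apply/funext => i; rewrite /upd; case: eqP => [->|].
rewrite /splits -fE lhs rhs //.
apply: (eq_integral_weighted_comp (mX q)) => // B mB.
by rewrite -lhs -rhs // hB.
Qed.

(* Indicators are replaced by arbitrary functions one coordinate at a time. *)
Lemma indep_split_integral (A : pred I) (f : I -> R -> R) : indep_split A ->
  (forall i, measurable_fun [set: R] (f i)) -> (forall i x, 0 <= f i x) -> splits A f.
Proof.
move=> iA mf f0.
(* Here [s] lists the coordinates whose factor is not yet known to be an indicator. For empty [s]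
   the claim is [indep_split] itself. *)
suff H (s : seq I) (g : I -> R -> R) : (forall i, measurable_fun [set: R] (g i)) -> (forall i x, 0 <= g i x) ->
    (forall i, i \notin s -> exists2 B, measurable B & g i = \1_B) -> splits A g.
  by apply: (H (enum I)) => // i; rewrite mem_enum.
elim: s g => [|q s IH] g mg g0 gs.
  have /choice[B hB] : forall i, exists B, measurable B /\ g i = \1_B.
    by move=> i; have [//|B ? ?] := gs i _; exists B.
  have mB i : measurable (B i) by case: (hB i).
  have int (Q : pred I) : (\int[P]_w (\prod_(i | Q i) g i (X i w))%:E =
      P (\bigcap_(i in [set i | Q i]) X i @^-1` B i))%E.
    rewrite (eq_integral (fun w => (\1_(\bigcap_(i in [set i | Q i]) X i @^-1` B i) w)%:E)).
      rewrite integral_indic ?setIT //.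
      apply: fin_bigcap_measurable => // i _.
      by rewrite -[X in measurable X]setTI; exact: mX.
    move=> w _; congr EFin; rewrite -prod_indic; apply: eq_bigr => i _.
    by case: (hB i) => _ ->.
  rewrite /splits !int -iA //; congr (P (bigcap _ _)).
  by apply/seteqP; split.
have step B : measurable B -> splits A (upd g q \1_B).
  move=> mB; apply: IH => [i|i x|i ins].
  - by rewrite /upd; case: ifP.
  - by rewrite /upd; case: ifP.
  - rewrite /upd; case: eqVneq => [_|iq]; first by exists B.
    by apply: gs; rewrite inE negb_or iq.
have [Aq|nAq] := boolP (A q); first exact: (splits_step Aq).
(* A coordinate outside [A] is treated by exchanging the two blocks. *)
apply: splitsC; apply: (splits_step (q := q)) => // B mB.
apply: splitsC; rewrite (_ : (fun i => ~~ ~~ A i) = A); first exact: step.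
by apply/funext => i /=; rewrite negbK.
Qed.

End IndependentProducts.

(** * Variables with finite moments *)

Section Moments.
Context d (T : measurableType d) (R : realType) (P : probability T R).
Implicit Types f g h : T -> R.

(** Requiring all moments at once gives a class closed under sums and products, so that polynomials
    in the entries are integrable. *)
Definition has_moments f : Prop :=
  measurable_fun [set: T] f /\
  forall n, (\int[P]_w (`|f w| ^+ n)%:E < +oo)%E.

Lemma measurable_normX f n : measurable_fun [set: T] f ->
  measurable_fun [set: T] (fun w => `|f w| ^+ n).
Proof.
by move=> mf; apply: measurable_funX; exact: measurableT_comp.
Qed.

Lemma has_moments_dom f g h (C : R) (a b : nat) n :
  has_moments f -> has_moments g -> measurable_fun [set: T] h -> 0 <= C ->
  (forall w, `|h w| ^+ n <= C * (`|f w| ^+ a + `|g w| ^+ b)) ->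
  (\int[P]_w (`|h w| ^+ n)%:E < +oo)%E.
Proof.
move=> [mf If] [mg Ig] mh C0 le_h.
have mfa := measurable_normX a mf; have mgb := measurable_normX b mg.
apply: (@le_lt_trans _ _ (\int[P]_w (C%:E * ((`|f w| ^+ a)%:E + (`|g w| ^+ b)%:E)))%E).
  apply: ge0_le_integral => //.
  - exact/measurable_EFinP/measurable_normX.
  - apply: measurable_funeM; apply: emeasurable_funD; exact/measurable_EFinP.
  - by move=> w _; rewrite -EFinD -EFinM lee_fin.
rewrite ge0_integralZl //.
- rewrite ge0_integralD //.
  + by rewrite lte_mul_pinfty // ?lee_fin // lte_add_pinfty.
  + exact/measurable_EFinP.
  + exact/measurable_EFinP.
- apply: emeasurable_funD; exact/measurable_EFinP.
- by move=> w _; rewrite -EFinD lee_fin addr_ge0 // exprn_ge0.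
Qed.

Lemma has_moments_le f h : has_moments f -> measurable_fun [set: T] h ->
  (forall w, `|h w| <= `|f w|) -> has_moments h.
Proof.
move=> mf mh hf; split=> // n; apply: (has_moments_dom (n := n) (a := n) (b := n) mf mf mh ler01).
by move=> w; rewrite mul1r -[leLHS]addr0 lerD ?exprn_ge0 // lerXn2r ?nnegrE.
Qed.

Lemma has_moments_cst (c : R) : has_moments (cst c).
Proof.
split=> // n; rewrite (eq_integral (cst (`|c| ^+ n)%:E)) // integral_cst //.
by rewrite /= probability_setT mule1 ltry.
Qed.

Lemma has_momentsM f g : has_moments f -> has_moments g ->
  has_moments (fun w => f w * g w).
Proof.
move=> mf mg; have mh : measurable_fun [set: T] (fun w => f w * g w).
  by apply: measurable_funM; [case: mf|case: mg].
split=> // n; apply: (has_moments_dom (n := n) (a := n.*2) (b := n.*2) mf mg mh ler01).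
move=> w; rewrite mul1r normrM exprMn -!muln2 !exprM.
set x := _ ^+ n; set y := _ ^+ n.
have x0 : 0 <= x by rewrite exprn_ge0.
have y0 : 0 <= y by rewrite exprn_ge0.
case: (leP x y) => [xy|/ltW xy].
  by apply: le_trans (ler_wpM2r y0 xy) _; rewrite -expr2 lerDr exprn_ge0.
by apply: le_trans (ler_wpM2l x0 xy) _; rewrite -expr2 lerDl exprn_ge0.
Qed.

Lemma has_momentsD f g : has_moments f -> has_moments g ->
  has_moments (fun w => f w + g w).
Proof.
move=> mf mg; have mh : measurable_fun [set: T] (fun w => f w + g w).
  by apply: measurable_funD; [case: mf|case: mg].
split=> // n; apply: (has_moments_dom (n := n) (a := n) (b := n) (C := 2 ^+ n) mf mg mh).
  by rewrite exprn_ge0.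
move=> w; apply: (@le_trans _ _ ((2 * Num.max `|f w| `|g w|) ^+ n)).
  rewrite lerXn2r ?nnegrE ?mulr_ge0 ?le_max ?normr_ge0 //.
  apply: le_trans (ler_normD _ _) _.
  by rewrite mulr_natl mulr2n lerD // le_max lexx ?orbT.
rewrite exprMn ler_wpM2l ?exprn_ge0 //.
by case: (leP `|f w| `|g w|) => _; [rewrite lerDr|rewrite lerDl]; apply: exprn_ge0.
Qed.

Lemma has_moments_sum (J : Type) (r : seq J) (Q : pred J) (F : J -> T -> R) :
  (forall j, has_moments (F j)) -> has_moments (fun w => \sum_(j <- r | Q j) F j w).
Proof.
move=> mF; elim: r => [|j r IH].
  by under eq_fun do rewrite big_nil; exact: has_moments_cst.
under eq_fun do rewrite big_cons; case: (Q j) => //; exact: has_momentsD.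
Qed.

Lemma has_moments_prod (J : Type) (r : seq J) (Q : pred J) (F : J -> T -> R) :
  (forall j, has_moments (F j)) -> has_moments (fun w => \prod_(j <- r | Q j) F j w).
Proof.
move=> mF; elim: r => [|j r IH].
  by under eq_fun do rewrite big_nil; exact: has_moments_cst.
under eq_fun do rewrite big_cons; case: (Q j) => //; exact: has_momentsM.
Qed.

Lemma has_momentsX f n : has_moments f -> has_moments (fun w => f w ^+ n).
Proof.
move=> mf; elim: n => [|n IH]; first exact: has_moments_cst.
by under eq_fun do rewrite exprS; exact: has_momentsM.
Qed.

Lemma has_moments_integrable f : has_moments f -> P.-integrable [set: T] (EFin \o f).
Proof.
move=> [mf If]; apply/integrableP; split; first exact/measurable_EFinP.
by have := If 1%N; under eq_integral do rewrite expr1.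
Qed.

Lemma Rintegral_sum (J : Type) (r : seq J) (Q : pred J) (F : J -> T -> R) :
  (forall j, has_moments (F j)) ->
  \int[P]_w (\sum_(j <- r | Q j) F j w) = \sum_(j <- r | Q j) \int[P]_w F j w.
Proof.
move=> mF; elim: r => [|j r IH].
  under eq_Rintegral do rewrite big_nil; by rewrite big_nil Rintegral_cst // mul0r.
under eq_Rintegral do rewrite big_cons; rewrite big_cons; case: (Q j) => //.
rewrite RintegralD //; first by rewrite IH.
- exact: has_moments_integrable.
- exact/has_moments_integrable/has_moments_sum.
Qed.

Lemma prod_le_exp_max (s : seq R) : (0 < size s)%N -> all (fun x => 0 <= x) s ->
  exists2 x, x \in s & \prod_(y <- s) y <= x ^+ size s.
Proof.
elim: s => // x [|x' s] IH _ /= /andP[x0 s0].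
  by exists x; rewrite ?mem_head // big_seq1.
have [//|//|y ys ley] := IH.
have {}s0 : {in x' :: s, forall z, 0 <= z} by apply/allP.
have y0 : 0 <= y by exact: s0.
have [xy|/ltW yx] := leP x y.
  exists y; first by rewrite inE ys orbT.
  by rewrite big_cons exprS ler_pM // big_seq prodr_ge0.
exists x; first exact: mem_head.
rewrite big_cons exprS ler_wpM2l // (le_trans ley) // lerXn2r ?nnegrE //.
Qed.

(** Pointwise the product is at most the largest factor to the power [size r], hence at most the sum
    of all these powers. This replaces Hölder's inequality at the cost of the factor [size r]. The
    empty list is excluded because its product is 1. *)
Lemma Rintegral_prod_le (J : eqType) (r : seq J) (F : J -> T -> R) (C : R) :
  (0 < size r)%N -> (forall j, has_moments (F j)) ->
  (forall j, \int[P]_w (`|F j w| ^+ size r) <= C) ->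
  `|\int[P]_w (\prod_(j <- r) F j w)| <= (size r)%:R * C.
Proof.
move=> r0 mF FC.
have mP := has_moments_prod r xpredT mF.
have mN j : has_moments (fun w => `|F j w| ^+ size r).
  apply: has_momentsX; apply: has_moments_le (mF j) _ _.
    by apply: measurableT_comp => //; case: (mF j).
  by move=> w; rewrite normr_id.
apply: le_trans (le_normr_Rintegral _ (has_moments_integrable mP)) _ => //.
apply: (@le_trans _ _ (\int[P]_w (\sum_(j <- r) `|F j w| ^+ size r))).
  apply: le_Rintegral => //.
  - apply: has_moments_integrable; apply: (has_moments_le mP).
      by apply: measurableT_comp => //; case: mP.
    by move=> w; rewrite normr_id.
  - exact/has_moments_integrable/has_moments_sum.
  - move=> w _; rewrite normr_prod.
    have := @prod_le_exp_max [seq `|F j w| | j <- r].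
    rewrite size_map all_map big_map => /(_ r0)[|x /mapP[j jr ->] lex].
      by apply/allP => j _ /=.
    apply: le_trans lex _; rewrite (big_rem j jr) /= lerDl.
    by apply: sumr_ge0 => i _; rewrite exprn_ge0.
rewrite Rintegral_sum //; apply: (le_trans (ler_sum _ (fun j _ => FC j))).
by rewrite big_const_seq count_predT iter_addr addr0 mulr_natl.
Qed.
End Moments.

(** * Factorization of expectations of signed products *)

Section SignedProducts.
Context d (T : measurableType d) (R : realType) (P : probability T R).
Variables (I : finType) (X : I -> T -> R).
Hypothesis mX : forall i, has_moments P (X i).

(** Both sides are additive in each factor, so the factors are split one at a time into positive and
    negative parts, down to the nonnegative case. *)
Lemma indep_split_Rintegral (A : pred I) (f : I -> R -> R) :
  indep_split P X A ->
  (forall i, measurable_fun [set: R] (f i)) ->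
  (forall i, has_moments P (fun w => f i (X i w))) ->
  \int[P]_w (\prod_i f i (X i w)) =
  \int[P]_w (\prod_(i | A i) f i (X i w)) *
  \int[P]_w (\prod_(i | ~~ A i) f i (X i w)).
Proof.
move=> iA mf momf.
suff H (s : seq I) (g : I -> R -> R) : (forall i, measurable_fun [set: R] (g i)) ->
    (forall i, has_moments P (fun w => g i (X i w))) ->
    (forall i, i \notin s -> forall x, 0 <= g i x) ->
    \int[P]_w (\prod_i g i (X i w)) =
    \int[P]_w (\prod_(i | A i) g i (X i w)) *
    \int[P]_w (\prod_(i | ~~ A i) g i (X i w)).
  by apply: (H (enum I)) => // i; rewrite mem_enum.
elim: s g => [|q s IH] g mg momg g0.
  (* All factors are nonnegative here. The moments make both extended integrals finite, so that
     [fine] respects their product. *)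
  have := @indep_split_integral _ _ _ P _ X (fun i => (mX i).1) A g iA mg (fun i => g0 i isT).
  rewrite /splits /Rintegral => ->; rewrite fineM //; apply: integrable_fin_num => //;
  exact/has_moments_integrable/has_moments_prod.
pose upd h i := if i == q then h else g i.
pose gp x := Num.max (g q x) 0; pose gn x := Num.max (- g q x) 0.
have gE x : g q x = gp x - gn x.
  rewrite /gp /gn; case: (leP (g q x) 0) => h.
    by rewrite max_l ?oppr_ge0 // sub0r opprK.
  by rewrite max_r ?oppr_le0 ?subr0 // ltW.
have mgp : measurable_fun [set: R] gp by exact: measurable_maxr.
have mgn : measurable_fun [set: R] gn.
  by apply: measurable_maxr => //; exact: measurableT_comp.
have momgp : has_moments P (fun w => gp (X q w)).
  apply: has_moments_le (momg q) _ _; first by apply: measurableT_comp => //; case: (mX q).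
  move=> w; rewrite /gp; case: (leP (g q (X q w)) 0) => // _; by rewrite normr0.
have momgn : has_moments P (fun w => gn (X q w)).
  apply: has_moments_le (momg q) _ _; first by apply: measurableT_comp => //; case: (mX q).
  move=> w; rewrite /gn; case: (leP (- g q (X q w)) 0) => // _; rewrite ?normr0 ?normrN //.
have mupd h : measurable_fun [set: R] h -> forall i, measurable_fun [set: R] (upd h i).
  by move=> mh i; rewrite /upd; case: ifP.
have momupd h : has_moments P (fun w => h (X q w)) ->
    forall i, has_moments P (fun w => upd h i (X i w)).
  by move=> mh i; rewrite /upd; case: eqP => [->|].
have IHupd (h : R -> R) : measurable_fun [set: R] h -> has_moments P (fun w => h (X q w)) ->
    (forall x, 0 <= h x) ->
    \int[P]_w (\prod_i upd h i (X i w)) =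
    \int[P]_w (\prod_(i | A i) upd h i (X i w)) *
    \int[P]_w (\prod_(i | ~~ A i) upd h i (X i w)).
  move=> mh momh h0; apply: IH; [exact: mupd|exact: momupd|].
  move=> i ins; rewrite /upd; case: eqVneq => [//|iq] x.
  by apply: g0; rewrite inE negb_or iq.
have lin (Q : pred I) : Q q -> \int[P]_w (\prod_(i | Q i) g i (X i w)) =
    \int[P]_w (\prod_(i | Q i) upd gp i (X i w)) -
    \int[P]_w (\prod_(i | Q i) upd gn i (X i w)).
  move=> Qq; rewrite -RintegralB //; last 2 first.
  - exact/has_moments_integrable/has_moments_prod/momupd.
  - exact/has_moments_integrable/has_moments_prod/momupd.
  apply: eq_Rintegral => w _; rewrite !(bigD1 q Qq) /= {1 3}/upd eqxx gE mulrBl.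
  by congr (_ * _ - _ * _); apply: eq_bigr => i /andP[_ /negPf iq]; rewrite /upd iq.
have noq (Q : pred I) h : ~~ Q q -> \int[P]_w (\prod_(i | Q i) upd h i (X i w)) =
    \int[P]_w (\prod_(i | Q i) g i (X i w)).
  move=> nQ; apply: eq_Rintegral => w _; apply: eq_bigr => i Qi.
  by rewrite /upd; case: eqP => // iq; rewrite -iq Qi in nQ.
have gp0 x : 0 <= gp x by rewrite le_max lexx orbT.
have gn0 x : 0 <= gn x by rewrite le_max lexx orbT.
rewrite (lin predT) // !IHupd //.
have [Aq|nAq] := boolP (A q).
  by rewrite (lin A) // !(noq (fun i => ~~ A i)) ?negbK // -mulrBl.
by rewrite (lin (fun i => ~~ A i)) // !(noq A) // -mulrBr.
Qed.

Lemma prod_seq_exp_count (V : comNzRingType) (L : seq I) (Q : pred I) (F : I -> V) :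
  \prod_(e <- L | Q e) F e = \prod_(i | Q i) F i ^+ count_mem i L.
Proof.
rewrite (partition_big id Q) //=; apply: eq_bigr => i Qi.
rewrite (eq_big (pred1 i) (fun=> F i)) => [|e|e /andP[_ /eqP->]//].
  by rewrite big_const_seq iter_mulr_1.
by rewrite /=; case: eqP => [->|]; rewrite ?Qi ?andbF.
Qed.

(** Repeated entries of [L] are gathered into powers, which gives one function [x ^+ count_mem i L]
    for each index. *)
Lemma indep_split_prod_seq (A : pred I) (L : seq I) : indep_split P X A ->
  \int[P]_w (\prod_(e <- L) X e w) =
  \int[P]_w (\prod_(e <- L | A e) X e w) * \int[P]_w (\prod_(e <- L | ~~ A e) X e w).
Proof.
move=> iA.
under eq_Rintegral do rewrite prod_seq_exp_count.
under [X in _ = X * _]eq_Rintegral do rewrite prod_seq_exp_count.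
under [X in _ = _ * X]eq_Rintegral do rewrite prod_seq_exp_count.
apply: (indep_split_Rintegral (f := fun i x => x ^+ count_mem i L)) => // i.
exact: has_momentsX.
Qed.
End SignedProducts.

(** * Covariances of walks *)

(** The factorization over classes is applied to [B] and to the two families that keep [B] only
    where [a] is true, respectively false. In each class one of these two families gives probability
    1 and the other the factor of [B]. *)
Lemma indep_over_classes_split d (T : measurableType d) (P : probability T Rst)
    (N : nat) (eqv : rel (ipair N)) (X : 'I_N -> 'I_N -> T -> Rst)
    (a : pred {set ipair N}) :
  equivalence_rel eqv -> indep_over_classes P eqv X ->
  indep_split P (fun p : ipair N => X p.1 p.2) (fun p => a (eqclass eqv p)).
Proof.
move=> eqvE iX B mB.
pose on (b : bool) i j := if a (eqclass eqv (i, j)) == b then B (i, j) else [set: Rst].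
have on_bigcap b : \bigcap_(p in [set p | a (eqclass eqv p) == b]) X p.1 p.2 @^-1` B p =
    \bigcap_(p in [set: ipair N]) X p.1 p.2 @^-1` on b p.1 p.2.
  apply/seteqP; split => w wB p /=.
    by rewrite /on; case: ifP => // ap _; case: p ap => i j; exact: wB.
  by move=> ap; have := wB p I; rewrite /on /=; case: p ap => i j /= ->.
have mon b i j : measurable (on b i j) by rewrite /on; case: ifP.
rewrite (_ : [set p | a _] = [set p | a (eqclass eqv p) == true]); last first.
  by apply/seteqP; split => p /=; rewrite eqb_id.
rewrite (_ : [set p | ~~ a _] = [set p | a (eqclass eqv p) == false]); last first.
  by apply/seteqP; split => p /=; rewrite eqbF_neg.
rewrite !on_bigcap (iX _ (mon true)) (iX _ (mon false)).
have := iX (fun i j => B (i, j)) (fun i j => mB (i, j)) => /=.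
rewrite (_ : \bigcap_(p in _) _ = \bigcap_(i in [set: ipair N]) (X i.1 i.2 @^-1` B i)); last first.
  by apply: eq_bigcapr => -[i j].
move=> ->; rewrite -big_split /=; apply: eq_bigr => C /imsetP[x _ ->].
set Cx := [set q | _].
have Cxa p : Cx p -> a (eqclass eqv p) = a (eqclass eqv x).
  rewrite /Cx /= inE => /andP[_ xp]; congr a; apply/esym/eqP.
  by rewrite eq_eqclass.
have onT b : (a (eqclass eqv x) == b) = false ->
    P (\bigcap_(p in Cx) X p.1 p.2 @^-1` on b p.1 p.2) = 1%E.
  move=> ab; rewrite (_ : \bigcap_(_ in _) _ = setT) ?probability_setT //.
  by apply/seteqP; split => // w _ [i j] /= /Cxa; rewrite /on => ->; rewrite ab.
have onB b : a (eqclass eqv x) = b ->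
    P (\bigcap_(p in Cx) X p.1 p.2 @^-1` on b p.1 p.2) =
    P (\bigcap_(p in Cx) X p.1 p.2 @^-1` B (p.1, p.2)).
  move=> ab; congr (P _); apply: eq_bigcapr => -[i j] /= /Cxa.
  by rewrite /on => ->; rewrite ab eqxx.
case ax: (a (eqclass eqv x)).
  by rewrite (onB true) // (onT false) ?ax // mule1.
by rewrite (onB false) // (onT true) ?ax // mul1e.
Qed.

(** * Variance of a linear combination *)

Section VarianceOfSum.
Context d (T : measurableType d) (R : realType) (P : probability T R).

Lemma variance_has_moments (Y : T -> R) : has_moments P Y ->
  ('V_P[Y] = (\int[P]_w (Y w * Y w) - (\int[P]_w Y w) ^+ 2)%:E)%E.
Proof.
move=> mY; rewrite /variance unlock /covariance.body unlock /expectation.body.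
have iY := has_moments_integrable mY.
set m := fine _; have -> : \int[P]_w Y w = m by [].
have mYY : has_moments P (fun w => (Y w - m) * (Y w - m)).
  by apply: has_momentsM; apply: has_momentsD => //; exact: has_moments_cst.
rewrite -[LHS]fineK; last exact: (integrable_fin_num _ (has_moments_integrable mYY)).
congr EFin; rewrite -[fine _]/(\int[P]_w ((Y w - m) * (Y w - m))).
have -> : \int[P]_w ((Y w - m) * (Y w - m)) =
    \int[P]_w (Y w * Y w + ((- m *+ 2) * Y w + m ^+ 2)).
  by apply: eq_Rintegral => w _; ring.
have mY2 := has_momentsM mY mY.
have mcY : has_moments P (fun w => (- m *+ 2) * Y w).
  by apply: has_momentsM => //; exact: has_moments_cst.
have mc := has_moments_cst P (m ^+ 2).
rewrite !RintegralD //; do ?exact: has_moments_integrable; last first.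
  exact: has_moments_integrable (has_momentsD mcY mc).
rewrite RintegralZl // Rintegral_cst //= probability_setT mulr1.
by rewrite -[\int[P]_w Y w]/m; ring.
Qed.

Lemma variance_linear_comb (J : finType) (c : J -> R) (F : J -> T -> R) :
  (forall j, has_moments P (F j)) ->
  ('V_P[(fun w => \sum_j c j * F j w)%R] =
   (\sum_i \sum_j c i * c j *
     (\int[P]_w (F i w * F j w) - \int[P]_w F i w * \int[P]_w F j w))%:E)%E.
Proof.
move=> mF.
have mcF j : has_moments P (fun w => c j * F j w).
  by apply: has_momentsM => //; exact: has_moments_cst.
rewrite variance_has_moments; last exact: has_moments_sum.
congr EFin.
rewrite Rintegral_sum // expr2 mulr_suml.
have -> : \int[P]_w ((\sum_j c j * F j w) * (\sum_j c j * F j w)) =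
    \sum_i \sum_j c i * c j * \int[P]_w (F i w * F j w).
  under eq_Rintegral do rewrite mulr_suml; rewrite Rintegral_sum; last first.
    by move=> i; apply: has_momentsM => //; exact: has_moments_sum.
  apply: eq_bigr => i _; under eq_Rintegral do rewrite mulr_sumr.
  rewrite Rintegral_sum; last by move=> j; exact: has_momentsM.
  apply: eq_bigr => j _.
  rewrite -RintegralZl //; last exact/has_moments_integrable/has_momentsM.
  by apply: eq_Rintegral => w _; rewrite mulrACA.
rewrite -sumrB; apply: eq_bigr => i _; rewrite mulr_sumr -sumrB.
apply: eq_bigr => j _; rewrite mulrBr; congr (_ - _).
by rewrite !RintegralZl //; do ?exact: has_moments_integrable; rewrite mulrACA.
Qed.
End VarianceOfSum.

(** * Covariances of pairs of closed walks and the resulting variance bound *)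

Section CovarianceOfWalks.
Context d (T : measurableType d) (P : probability T Rst).
Variables (N : nat) (X : 'I_N -> 'I_N -> T -> Rst) (eqv : rel (ipair N)).
Hypothesis X_moments : forall p : ipair N, has_moments P (X p.1 p.2).
Hypothesis X_mean : forall p : ipair N, \int[P]_w X p.1 p.2 w = 0.
Hypothesis eqv_equiv : equivalence_rel eqv.
Hypothesis X_indep : indep_over_classes P eqv X.

Let cls := eqclass eqv.

(** The class of [e] is independent of all others and contributes only the entry at [e], which is
    centred. *)
Lemma Rintegral_lonely_class (L : seq (ipair N)) (e : ipair N) :
  e \in L -> (count_mem (cls e) (map cls L) <= 1)%N ->
  \int[P]_w (\prod_(p <- L) X p.1 p.2 w) = 0.
Proof.
move=> eL ce.
rewrite (indep_split_prod_seq X_moments L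
  (indep_over_classes_split (pred1 (cls e)) eqv_equiv X_indep)).
have flt : [seq p <- L | pred1 (cls e) (cls p)] = [:: e].
  set l := (LHS).
  have el : e \in l by rewrite mem_filter /= eqxx.
  have : (size l <= 1)%N by rewrite size_filter; move: ce; rewrite count_map.
  by case: l el => [|f [|? ?]] //; rewrite inE => /eqP ->.
under eq_Rintegral do rewrite -big_filter flt big_seq1.
by rewrite X_mean mul0r.
Qed.

Lemma covariance_closed_walks_eq0 (s t : seq 'I_N) :
  ~~ (doubled cls (closed_edges s ++ closed_edges t) && linked cls s t) ->
  \int[P]_w ((\prod_(p <- closed_edges s) X p.1 p.2 w) *
             (\prod_(p <- closed_edges t) X p.1 p.2 w)) -
  \int[P]_w (\prod_(p <- closed_edges s) X p.1 p.2 w) *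
  \int[P]_w (\prod_(p <- closed_edges t) X p.1 p.2 w) = 0.
Proof.
set Es := closed_edges s; set Et := closed_edges t.
have -> : \int[P]_w ((\prod_(p <- Es) X p.1 p.2 w) * (\prod_(p <- Et) X p.1 p.2 w)) =
    \int[P]_w (\prod_(p <- Es ++ Et) X p.1 p.2 w).
  by apply: eq_Rintegral => w _; rewrite big_cat.
(* If a class is visited only once in total, the joint expectation vanishes, and so does that of the
   walk making the visit. *)
rewrite negb_and => /orP[/allPn[_ /mapP[e eL ->]]|].
  rewrite -leqNgt => ce; rewrite (Rintegral_lonely_class eL ce) sub0r.
  move: ce; rewrite map_cat count_cat => ce.
  move: eL; rewrite mem_cat => /orP[es|et].
    rewrite (Rintegral_lonely_class es) ?mul0r ?oppr0 //.
    exact: leq_trans (leq_addr _ _) ce.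
  rewrite (Rintegral_lonely_class et) ?mulr0 ?oppr0 //.
  exact: leq_trans (leq_addl _ _) ce.
move=> /hasPn unlinked.
(* Without a common class, splitting along the classes of [s] separates exactly the edges of [s]
   from those of [t]. *)
rewrite (indep_split_prod_seq X_moments (Es ++ Et)
  (indep_over_classes_split (fun c => c \in map cls Es) eqv_equiv X_indep)).
have inEs e : e \in Es -> cls e \in map cls Es by move=> ?; apply: map_f.
have inEt e : e \in Et -> cls e \notin map cls Es.
  move=> et; apply/mapP => -[f fs ef].
  by have := unlinked f fs; rewrite -ef map_f.
apply/eqP; rewrite subr_eq0; apply/eqP; congr (_ * _).
  apply: eq_Rintegral => w _; rewrite big_cat /= [X in _ * X]big1_seq ?mulr1.
    by rewrite big_seq_cond [RHS]big_seq; apply: eq_bigl => e; case: (boolP (e \in Es)) => // /inEs ->.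
  by move=> e /andP[ce /inEt]; rewrite /cls ce.
apply: eq_Rintegral => w _; rewrite big_cat /= [X in X * _]big1_seq ?mul1r.
  by rewrite big_seq_cond [RHS]big_seq; apply: eq_bigl => e; case: (boolP (e \in Et)) => // /inEt ->.
by move=> e /andP[/negP ce /inEs]; rewrite /cls => /ce.
Qed.

Variables (Rk : nat -> Rst).
Hypothesis X_Rk : forall n (p : ipair N), \int[P]_w (`|X p.1 p.2 w| ^+ n) <= Rk n.

Lemma covariance_closed_walks_le (k : nat) (s t : k.+1.-tuple 'I_N) :
  `|\int[P]_w ((\prod_(p <- closed_edges s) X p.1 p.2 w) *
             (\prod_(p <- closed_edges t) X p.1 p.2 w)) -
  \int[P]_w (\prod_(p <- closed_edges s) X p.1 p.2 w) *
  \int[P]_w (\prod_(p <- closed_edges t) X p.1 p.2 w)| <=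
  k.+1.*2%:R * Rk k.+1.*2 + (k.+1%:R * Rk k.+1) ^+ 2.
Proof.
set Es := closed_edges s; set Et := closed_edges t.
have -> : \int[P]_w ((\prod_(p <- Es) X p.1 p.2 w) * (\prod_(p <- Et) X p.1 p.2 w)) =
    \int[P]_w (\prod_(p <- Es ++ Et) X p.1 p.2 w).
  by apply: eq_Rintegral => w _; rewrite big_cat.
have sEs : size Es = k.+1 by rewrite size_closed_edges size_tuple.
have sEt : size Et = k.+1 by rewrite size_closed_edges size_tuple.
have sL : size (Es ++ Et) = k.+1.*2 by rewrite size_cat sEs sEt addnn.
have bound L : (0 < size L)%N ->
    `|\int[P]_w (\prod_(p <- L) X p.1 p.2 w)| <= (size L)%:R * Rk (size L).
  by move=> L0; apply: Rintegral_prod_le.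
apply: le_trans (ler_normB _ _) _; apply: lerD; first by rewrite -sL bound // sL.
have := bound Es; rewrite sEs => /(_ isT) bs.
have := bound Et; rewrite sEt => /(_ isT) bt.
by rewrite normrM expr2 ler_pM.
Qed.

Variables (B : nat) (alpha : Rst -> Rst) (Ma : Rst).
Hypothesis C2 : forall p q r : 'I_N, (countC2 eqv p q r <= B)%N.
Hypothesis alphaM : forall x : Rst, 0 <= x <= 1 -> `|alpha x| <= Ma.

(** The factors bound, in this order, the rotations and completions of a pair of walks, the values
    of [alpha] along its edges, and its covariance. None of them depends on [N]. *)
Definition var_const (k : nat) : Rst :=
  (k.+1 ^ 2 * (k.+1.*2 * B).+1 ^ k.*2)%:R * Ma ^+ k.+1.*2 *
  (k.+1.*2%:R * Rk k.+1.*2 + (k.+1%:R * Rk k.+1) ^+ 2).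

(** The number of contributing pairs is at most a constant times [N ^ k.+1 * countC1 eqv], and each
    has weight of order [N ^- (k+3)]. The witness [v] records that the variance is finite. *)
Lemma variance_Ytr_le (k : nat) : exists2 v : Rst,
  'V_P[Ytr k.+1 alpha X] = v%:E &
  `|v| <= var_const k * ((countC1 eqv)%:R / N%:R ^+ 2).
Proof.
pose al (p : ipair N) : Rst :=
  alpha ((maxn p.1 p.2 - minn p.1 p.2)%:R / N%:R) / Num.sqrt N%:R.
pose c (s : k.+1.-tuple 'I_N) : Rst := (\prod_(p <- closed_edges s) al p) / N%:R.
pose F (s : k.+1.-tuple 'I_N) w := \prod_(p <- closed_edges s) X p.1 p.2 w.
have YE : Ytr k.+1 alpha X = (fun w => \sum_s c s * F s w).
  apply/funext => w; rewrite /Ytr RdivE trace_exp_closed_walks mulr_suml.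
  apply: eq_bigr => s _; rewrite /c /F mulrAC -big_split /=; congr (_ / _).
  by apply: eq_bigr => p _; rewrite mxE /al mulrAC.
have mF s : has_moments P (F s) by exact: has_moments_prod.
rewrite YE (variance_linear_comb c mF); eexists; first by [].
have N_ge0 : 0 <= N%:R :> Rst by [].
have al_le p : `|al p| <= Ma / Num.sqrt N%:R.
  rewrite normrM normfV (ger0_norm (sqrtr_ge0 _)) ler_wpM2r ?invr_ge0 ?sqrtr_ge0 //.
  apply: alphaM; have [N0|N0] := posnP N.
    by case: p => -[i Hi]; exfalso; rewrite N0 in Hi.
  rewrite divr_ge0 // ler_pdivrMr ?ltr0n // mul1r ler_nat.
  apply: leq_trans (leq_subr _ _) _; rewrite geq_max.
  by rewrite !(ltnW (ltn_ord _)).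
have c_le s : `|c s| <= (Ma / Num.sqrt N%:R) ^+ k.+1 / N%:R.
  rewrite normrM normfV (ger0_norm N_ge0) ler_wpM2r ?invr_ge0 // normr_prod.
  rewrite -[in leRHS](size_tuple s) -size_closed_edges.
  elim: (closed_edges s) => [|p L IH]; first by rewrite big_nil.
  by rewrite big_cons /= exprS ler_pM // prodr_ge0.
(* The [2(k+1)] factors [1 / sqrt N] give [N ^+ k.+1] in the denominator, and the two normalizations
   of the trace give [N ^+ 2]. *)
have cc_le s t : `|c s * c t| <= Ma ^+ k.+1.*2 / (N%:R ^+ k.+1 * N%:R ^+ 2).
  rewrite normrM; apply: le_trans (ler_pM _ _ (c_le s) (c_le t)) _ => //.
  rewrite mulrACA -[X in X * _ <= _]exprD addnn expr_div_n -mul2n [X in _ / X * _]exprM sqr_sqrtr //.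
  by rewrite -mulrA -!invfM -expr2 lexx.
set K := k.+1.*2%:R * Rk k.+1.*2 + (k.+1%:R * Rk k.+1) ^+ 2.
have K_ge0 (s t : k.+1.-tuple 'I_N) : 0 <= K by apply: le_trans (covariance_closed_walks_le s t).
(* Only these pairs can have a nonzero covariance. *)
pose bad := finset (fun st : k.+1.-tuple 'I_N * k.+1.-tuple 'I_N =>
  doubled cls (closed_edges st.1 ++ closed_edges st.2) && linked cls st.1 st.2).
have card_bad : (#|bad| <= k.+1 ^ 2 * (N ^ k.+1 * ((k.+1.*2 * B).+1 ^ k.*2 * countC1 eqv)))%N.
  have cB e v : (#|finset (fun x => cls e == cls (v, x))| <= B)%N.
    case: e => p q; apply: leq_trans (C2 p q v).
    by apply/subset_leq_card/fintype.subsetP => x; rewrite !inE eq_eqclass.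
  have cD v : (#|finset (fun z : 'I_N * 'I_N * 'I_N =>
      cls (v, z.1.1) == cls (z.1.2, z.2))| <= countC1 eqv)%N.
    apply: leq_trans (leq_bigmax v) => /=.
    by apply/subset_leq_card/fintype.subsetP => z; rewrite !inE eq_eqclass.
  by have := card_doubled_linked_le cB cD k; rewrite card_ord.
rewrite pair_bigA /=.
apply: (@le_trans _ _ (\sum_(st in bad) (Ma ^+ k.+1.*2 / (N%:R ^+ k.+1 * N%:R ^+ 2) * K))).
  apply: le_trans (ler_norm_sum _ _ _) _; rewrite [leRHS]big_mkcond /=.
  apply: ler_sum => -[s t] _ /=; rewrite inE /=; case: ifPn => [_|st_ok].
    by rewrite normrM ler_pM // covariance_closed_walks_le.
  by rewrite covariance_closed_walks_eq0 // mulr0 normr0.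
rewrite sumr_const.
(* For [N = 0] there are no pairs, and the right-hand side is 0 because the inverse of 0 is 0. *)
have [N0|N0] := posnP N.
  have bad0 : #|bad| = 0%N.
    by apply/eqP; rewrite -leqn0; move: card_bad; rewrite [X in (_ * (X ^ _ * _))%N]N0 exp0n // mul0n muln0.
  have N0R : N%:R = 0 :> Rst by rewrite N0.
  by rewrite bad0 mulr0n N0R expr0n /= invr0 !mulr0.
have NR0 : N%:R != 0 :> Rst by rewrite pnatr_eq0 -lt0n.
rewrite -[leLHS]mulr_natl.
have Ma_ge0 : 0 <= Ma by apply: le_trans (alphaM (x := 0) _); rewrite ?lexx ?ler01.
have K0 : 0 <= K by exact: (K_ge0 (nseq_tuple k.+1 (Ordinal N0)) (nseq_tuple k.+1 (Ordinal N0))).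
apply: (@le_trans _ _ ((k.+1 ^ 2 * (N ^ k.+1 * ((k.+1.*2 * B).+1 ^ k.*2 * countC1 eqv)))%:R *
    (Ma ^+ k.+1.*2 / (N%:R ^+ k.+1 * N%:R ^+ 2) * K))).
  rewrite ler_wpM2r ?ler_nat //; apply: mulr_ge0 => //; apply: divr_ge0.
    exact: exprn_ge0.
  by apply: mulr_ge0; exact: exprn_ge0.
rewrite /var_const -/K !natrM !natrX le_eqVlt; apply/orP; left; apply/eqP.
have NX0 : N%:R ^+ k.+1 != 0 :> Rst by rewrite expf_neq0.
move: (N%:R ^+ k.+1 : Rst) NX0 => y y0.
by field; rewrite NR0.
Qed.
End CovarianceOfWalks.

(** * Convergence of the variances to zero *)

Theorem mainTheorem15
  (alpha : Rst -> Rst)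
  (alpha_bounded : exists Ma : Rst, forall x : Rst, 0 <= x <= 1 -> `|alpha x| <= Ma)
  (alpha_Riemann : Riemann_integrable01 alpha)
  (d : measure_display) (T : measurableType d) (P : probability T Rst)
  (X : forall N : nat, 'I_N -> 'I_N -> T -> Rst)
  (X_meas : forall N (i j : 'I_N),
     measurable_fun [set: T] (X N i j : T -> measurableTypeR Rst))
  (X_sym : forall N (i j : 'I_N), X N i j = X N j i)
  (X_mean : forall N (i j : 'I_N), ('E_P[X N i j] = 0)%E)
  (X_var : forall N (i j : 'I_N), ('E_P[X N i j ^+ 2] = 1)%E)
  (X_moments : exists Rk : nat -> Rst, forall (k : nat) N (i j : 'I_N),
     ('E_P[(fun w : T => `|X N i j w| ^+ k)%R] <= (Rk k)%:E)%E)
  (eqv : forall N : nat, rel (ipair N))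
  (eqv_equiv : forall N, equivalence_rel (eqv N))
  (eqv_swap : forall N (p q : 'I_N), eqv N (p, q) (q, p))
  (C1 : little_o_N2 (fun N => countC1 (eqv N)))
  (C2 : exists B : nat, forall N (p q r : 'I_N), (countC2 (eqv N) p q r <= B)%N)
  (C3 : little_o_N2 (fun N => countC3 (eqv N)))
  (X_indep : forall N, indep_over_classes P (eqv N) (X N)) :
  forall k : nat,
    (fun N : nat => 'V_P[Ytr k alpha (X N)]) @ \oo --> 0%E.
Proof.
have [Ma alphaM] := alpha_bounded; have [Rk XRk] := X_moments; have [B C2B] := C2.
have Xint N (p : ipair N) n : (\int[P]_w (`|X N p.1 p.2 w| ^+ n)%:E <= (Rk n)%:E)%E.
  by have := XRk n N p.1 p.2; rewrite unlock.
have Xmom N (p : ipair N) : has_moments P (X N p.1 p.2).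
  by split=> [|n]; [exact: X_meas|exact: le_lt_trans (Xint N p n) (ltry _)].
have Xmean N (p : ipair N) : \int[P]_w X N p.1 p.2 w = 0.
  by have := X_mean N p.1 p.2; rewrite unlock /Rintegral => ->.
have XintR N n (p : ipair N) : \int[P]_w (`|X N p.1 p.2 w| ^+ n) <= Rk n.
  rewrite /Rintegral -lee_fin fineK //.
  rewrite ge0_fin_numE; first exact: le_lt_trans (Xint N p n) (ltry _).
  by apply: integral_ge0 => w _; rewrite lee_fin exprn_ge0.
case=> [|k].
  (* The zeroth power is the identity matrix, so its normalized trace is constant and has variance
     0. *)
  rewrite (_ : (fun N => 'V_P[Ytr 0 alpha (X N)])%E = (fun=> 0%E)); first exact: cvg_cst.
  apply/funext => N; rewrite (_ : Ytr 0 alpha (X N) = cst (\tr (1 : 'M[Rst]_N) / N%:R)) //.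
  exact: variance_cst.
have /choice[v hv] : forall N, exists v : Rst, 'V_P[Ytr k.+1 alpha (X N)]%E = v%:E /\
    `|v| <= var_const Rk B Ma k * ((countC1 (eqv N))%:R / N%:R ^+ 2).
  move=> N; have [v v1 v2] := variance_Ytr_le (Xmom N) (Xmean N) (eqv_equiv N)
    (X_indep N) (XintR N) (C2B N) alphaM k.
  by exists v.
rewrite (_ : (fun N => 'V_P[Ytr k.+1 alpha (X N)])%E = EFin \o v); last first.
  by apply/funext => N /=; case: (hv N).
apply: cvg_EFin; first by apply: nearW.
(* By (C1) the bound tends to 0, its constant being independent of [N]; squeezing the norm of [v N]
   below it gives the limit. *)
have lim0 : (var_const Rk B Ma k * ((countC1 (eqv N))%:R / N%:R ^+ 2)) @[N --> \oo] --> (0 : Rst).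
  by rewrite -(mulr0 (var_const Rk B Ma k)); apply: cvgMl_tmp; exact: C1.
apply/norm_cvg0P.
apply: (@squeeze_cvgr _ _ _ _ (fun=> 0) _ _ _ 0 _ lim0); last exact: cvg_cst.
by apply: nearW => N /=; rewrite normr_ge0; case: (hv N).
Qed.
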